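(* Let $A\in\mathbb{R}^{m\times n}$ and let $\mathcal{D}$ be a distribution over matrices $S\in\mathbb{R}^{m\times\tau}$. Let $X_0\in\mathbb{R}^{n\times m}$ with $\mathrm{Range}(X_0)\subset\mathrm{Range}(A^\top A)$, and define iterates $$X_{k+1} = X_k - A^\top A S_k\,(S_k^\top A^\top A A^\top A S_k)^\dagger S_k^\top A^\top (A X_k - I),\qquad k\ge 0,$$ where $S_0,S_1,\dots$ are drawn independently from $\mathcal{D}$. Let $H_S \eqdef S(S^\top A^\top A A^\top A S)^\dagger S^\top$ for $S\sim\mathcal{D}$. Then $$\mathbb{E}[X_{k+1}-A^\dagger] = \mathbb{E}[I - A^\top A H_S A^\top A]\;\mathbb{E}[X_k - A^\dagger].$$ Furthermore, if $\mathbb{E}[H_S]$ is finite and positive definite, then $$\mathbb{E}\big[\|X_k - A^\dagger\|^2\big]\le \rho^k\,\|X_0-A^\dagger\|^2,\qquad \rho = 1-\lambda_{\min}^+\big(A^\top A\,\mathbb{E}[H_S]\,A^\top A\big).$$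
   Context: $M^\dagger$ denotes the Moore–Penrose pseudoinverse of a real matrix $M$; $\|\cdot\|$ is the Frobenius norm; $\mathrm{Range}(M)$ is the column space of $M$. For a symmetric positive semidefinite matrix $G$, $\lambda_{\min}^+(G)$ denotes its smallest nonzero eigenvalue.
   Formalization: The matrices S are taken in R^{n×τ} instead of R^{m×τ}: the product AᵀA S in the iteration and in H_S is undefined for S in R^{m×τ} unless m = n, in which case the two readings agree. *)

(* Defs.v *)
From HB Require Import structures.
From mathcomp Require Import all_boot all_order all_algebra.
From mathcomp Require Import all_classical all_reals all_analysis.
Set Implicit Arguments. Unset Strict Implicit. Unset Printing Implicit Defensive.
Import Order.TTheory GRing.Theory Num.Theory.
Local Open Scope classical_set_scope.
Local Open Scope ring_scope.

Section Defs.
Variable R : realType.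

(* Moore--Penrose pseudoinverse: the (unique) matrix satisfying the four
   Penrose conditions (chosen classically; such a matrix always exists). *)
Definition mx_pinv (p q : nat) (M : 'M[R]_(p, q)) : 'M[R]_(q, p) :=
  xget 0 [set X : 'M[R]_(q, p) | [/\ M *m X *m M = M, X *m M *m X = X,
                                     (M *m X)^T = M *m X & (X *m M)^T = X *m M]].

Definition frob (p q : nat) (M : 'M[R]_(p, q)) : R :=
  Num.sqrt (\sum_(i < p) \sum_(j < q) M i j ^+ 2).

Definition range_sub (p q r : nat) (M : 'M[R]_(p, q)) (N : 'M[R]_(p, r)) : bool :=
  (M^T <= N^T)%MS.

Definition posdef (p : nat) (M : 'M[R]_p) : Prop :=
  M^T = M /\ forall x : 'cV[R]_p, x != 0 -> 0 < (x^T *m M *m x) ord0 ord0.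

(* Smallest nonzero eigenvalue (0 if there is none). *)
Definition lambda_min_pos (p : nat) (G : 'M[R]_p) : R :=
  xget 0 [set x : R | [/\ eigenvalue G x, x != 0 &
            forall y, eigenvalue G y -> y != 0 -> x <= y]].

Definition mx_borel (p q : nat) : set (set 'M[R]_(p, q)) :=
  <<s [set E | exists (i : 'I_p) (j : 'I_q) (C : set R),
                 measurable C /\ E = [set M : 'M[R]_(p, q) | C (M i j)]] >>.

Section Prob.
Context {d : measure_display} {T : measurableType d} (P : probability T R).

Definition random_mx (p q : nat) (S : T -> 'M[R]_(p, q)) : Prop :=
  forall B, mx_borel B -> measurable (S @^-1` B).

Definition mx_indep (p q : nat) (S : nat -> T -> 'M[R]_(p, q)) : Prop :=
  forall (n : nat) (B : nat -> set 'M[R]_(p, q)), (forall i, mx_borel (B i)) ->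
    P (\big[setI/setT]_(i < n) (S i @^-1` B i)) =
    (\prod_(i < n) P (S i @^-1` B i))%E.

Definition mx_ident_distr (p q : nat) (S : nat -> T -> 'M[R]_(p, q)) : Prop :=
  forall k B, mx_borel B -> P (S k @^-1` B) = P (S 0%N @^-1` B).

Definition mexp (p q : nat) (F : T -> 'M[R]_(p, q)) : 'M[R]_(p, q) :=
  \matrix_(i, j) Rintegral P setT (fun w => F w i j).

Definition mx_integrable (p q : nat) (F : T -> 'M[R]_(p, q)) : Prop :=
  forall i j, P.-integrable setT (fun w => (F w i j)%:E).
End Prob.

Definition H_of (m n tau : nat) (A : 'M[R]_(m, n)) (S : 'M[R]_(n, tau)) : 'M[R]_n :=
  S *m mx_pinv (S^T *m (A^T *m A) *m (A^T *m A) *m S) *m S^T.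

Fixpoint Xit {T : Type} (m n tau : nat) (A : 'M[R]_(m, n)) (X0 : 'M[R]_(n, m))
  (S : nat -> T -> 'M[R]_(n, tau)) (k : nat) (w : T) : 'M[R]_(n, m) :=
  match k with
  | 0 => X0
  | k'.+1 =>
    let Xk := Xit A X0 S k' w in
    let Sk := S k' w in
    Xk - (A^T *m A) *m Sk *m mx_pinv (Sk^T *m (A^T *m A) *m (A^T *m A) *m Sk)
           *m Sk^T *m A^T *m (A *m Xk - 1%:M)
  end.
End Defs.

(* Main.v *)
(* With G = A^T A and W = G S, the matrix G H_S G = W (W^T W)^+ W^T is the orthogonal
   projector onto the range of W, and the errors Y_k = X_k - A^+ satisfy
   Y_{k+1} = (1 - G H_{S_k} G) Y_k.  A projector has entries in [-1, 1], so all
   expectations of products of entries exist unconditionally; Gram--Schmidt gives the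
   projector as a Borel function of S, so independence factors these expectations.
   Since 1 - G H_S G is idempotent and symmetric,
   E |Y_{k+1}|^2 = E tr (Y_k^T (1 - G E[H_S] G) Y_k), and the columns of Y_k stay in the
   range of G, on which the Rayleigh quotient of G E[H_S] G is minimized, by compactness,
   at an eigenvector with positive eigenvalue. *)
Require Import Defs.
From HB Require Import structures.
From mathcomp Require Import all_boot all_order all_algebra.
From mathcomp Require Import all_classical all_reals all_analysis.
From mathcomp Require Import measurable_realfun.
From mathcomp Require Import ring.
Import Order.TTheory GRing.Theory Num.Theory.
Local Open Scope classical_set_scope.
Local Open Scope ring_scope.

Set Implicit Arguments. Unset Strict Implicit. Unset Printing Implicit Defensive.

(** * Orthogonal projectors, Gram--Schmidt and the pseudoinverse *)

Section OrthogonalProjection.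
Context {R : realType}.

Lemma gram_eq0 (p q : nat) (M : 'M[R]_(p, q)) : M^T *m M = 0 -> M = 0.
Proof.
move=> MM0; apply/matrixP => i j; rewrite mxE.
have := congr1 (fun N : 'M[R]_q => N j j) MM0; rewrite !mxE => /eqP.
rewrite psumr_eq0 => [/allP/(_ i (mem_index_enum i))|k _]; last first.
  by rewrite !mxE -expr2 sqr_ge0.
by rewrite /= !mxE -expr2 sqrf_eq0 => /eqP.
Qed.

Lemma cV_gram (p : nat) (v : 'cV[R]_p) : v^T *m v = ((v^T *m v) 0 0)%:M.
Proof. exact: mx11_scalar. Qed.

Definition orthoproj {p : nat} (Z : 'M[R]_p) : Prop := Z^T = Z /\ Z *m Z = Z.

Lemma orthoproj_compl (p : nat) (Z : 'M[R]_p) :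
  orthoproj Z -> orthoproj (1%:M - Z).
Proof.
move=> [ZT ZZ]; split; first by rewrite linearB /= trmx1 ZT.
by rewrite mulmxBl mul1mx mulmxBr mulmx1 ZZ subrr subr0.
Qed.

(** [Z = Z *m Z^T] makes [Z k k] the squared norm of row [k], which dominates each [Z k l ^+ 2];
    taking [l = k] gives [Z k k <= 1]. *)
Lemma orthoproj_entry_le1 (p : nat) (Z : 'M[R]_p) i j :
  orthoproj Z -> `|Z i j| <= 1.
Proof.
move=> [ZT ZZ].
have Zsq k l : Z k l ^+ 2 <= Z k k.
  rewrite -{2}ZZ mxE (bigD1 l) //= -{3}ZT mxE -expr2 lerDl sumr_ge0 // => h _.
  by rewrite -{2}ZT mxE -expr2 sqr_ge0.
have Zd k : Z k k <= 1.
  have := Zsq k k; rewrite expr2 => h; rewrite leNgt; apply/negP => k1.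
  by move: h; apply/negP; rewrite -ltNge ltr_pMr // (lt_trans _ k1).
by rewrite -(@expr_le1 _ 2) // real_normK ?num_real // (le_trans (Zsq i j)).
Qed.

(* Gram--Schmidt; a column already in the span contributes [v = 0], and
   [0^-1 = 0] makes the update vanish. *)
Definition gs_step {p q : nat} (W : 'M[R]_(p, q)) (j : 'I_q) (Z : 'M[R]_p) :=
  let v := (1%:M - Z) *m col j W in Z + (((v^T *m v) 0 0)^-1 *: (v *m v^T)).

Definition range_proj {p q : nat} (W : 'M[R]_(p, q)) : 'M[R]_p :=
  foldr (gs_step W) 0 (enum 'I_q).

(** The three conjuncts form the induction invariant. The residual [v] of column [j] satisfies
    [Z *m v = 0], so adding the projector onto the line of [v] keeps a projector and makes it fix
    column [j] as well. *)
Lemma gs_stepP (p q : nat) (W : 'M[R]_(p, q)) (s : seq 'I_q) :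
  let Z := foldr (gs_step W) 0 s in
  [/\ orthoproj Z, exists C, Z = W *m C &
      forall j, j \in s -> Z *m col j W = col j W].
Proof.
elim: s => [|j s [[ZT ZZ] [C ZC] Zs]] /=.
  split=> //; last by exists 0; rewrite mulmx0.
  by split; rewrite ?trmx0 ?mul0mx.
set Z := foldr _ _ _ in ZT ZZ ZC Zs *; rewrite /gs_step.
set v := (1%:M - Z) *m col j W; set a := (v^T *m v) 0 0.
have Zv : Z *m v = 0 by rewrite /v mulmxA mulmxBr mulmx1 ZZ subrr mul0mx.
have vZ : v^T *m Z = 0 by rewrite -{1}ZT -trmx_mul Zv trmx0.
have wE : col j W = v + Z *m col j W by rewrite /v mulmxBl mul1mx subrK.
have vvv : a^-1 *: (v *m v^T *m v) = v.
  rewrite -mulmxA cV_gram -/a mul_mx_scalar scalerA.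
  have [a0|a0] := eqVneq a 0; last by rewrite mulVf ?scale1r.
  suff -> : v = 0 by rewrite scaler0.
  by apply: gram_eq0; rewrite cV_gram -/a a0 raddf0.
split.
- split.
    by rewrite linearD /= linearZ /= trmx_mul trmxK ZT.
  rewrite mulmxDl !mulmxDr ZZ -!scalemxAr -!scalemxAl.
  rewrite (mulmxA Z) Zv mul0mx -(mulmxA v v^T Z) vZ mulmx0 !scaler0 addr0 add0r.
  by rewrite (mulmxA _ v) (scalemxAl _ _ v^T) vvv.
(* The residual lies in the range of [W]: [v = W *m (delta_mx j 0 - C *m col j W)]. *)
- exists (C + a^-1 *: ((delta_mx j 0 - C *m col j W) *m v^T)).
  rewrite mulmxDr -ZC -scalemxAr mulmxA mulmxBr -colE mulmxA -ZC.
  by rewrite /v mulmxBl mul1mx.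
- move=> i; rewrite in_cons mulmxDl -scalemxAl => /orP[/eqP->|/Zs Zi].
    rewrite {2}wE mulmxDr scalerDr vvv (mulmxA (v *m v^T)) -(mulmxA v v^T) vZ.
    by rewrite mulmx0 mul0mx scaler0 addr0 addrC -wE.
  rewrite -{2}Zi mulmxA -(mulmxA v v^T) vZ mulmx0 mul0mx scaler0 addr0.
  exact: Zi.
Qed.

Lemma range_proj_orthoproj (p q : nat) (W : 'M[R]_(p, q)) :
  orthoproj (range_proj W).
Proof. by have [] := gs_stepP W (enum 'I_q). Qed.

Lemma range_proj_factor (p q : nat) (W : 'M[R]_(p, q)) :
  exists C, range_proj W = W *m C.
Proof. by have [] := gs_stepP W (enum 'I_q). Qed.

Lemma range_proj_id (p q : nat) (W : 'M[R]_(p, q)) : range_proj W *m W = W.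
Proof.
have [_ _ h] := gs_stepP W (enum 'I_q).
apply/matrixP => i j; have := congr1 (fun v : 'cV_p => v i 0) (h j (mem_enum _ j)).
by rewrite !colE mulmxA -!colE !mxE.
Qed.

(** Each of the two matrices fixes the range of the other: [Z *m P = P] and [P *m Z = Z].
    Transposing the second equation gives [Z = Z *m P]. *)
Lemma range_proj_uniq (p q : nat) (W : 'M[R]_(p, q)) (Z : 'M[R]_p) C :
  Z^T = Z -> Z *m W = W -> Z = W *m C -> Z = range_proj W.
Proof.
move=> ZT ZW ZC; have [C' PC] := range_proj_factor W.
have [PT PP] := range_proj_orthoproj W.
have ZP : Z *m range_proj W = range_proj W by rewrite PC mulmxA ZW.
have PZ : range_proj W *m Z = Z by rewrite ZC mulmxA range_proj_id.
by rewrite -ZT -PZ trmx_mul ZT PT ZP.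
Qed.

(** The choice in [mx_pinv] needs an inhabitant. With [P = M *m C] the projector onto the column
    space and [Q] the one onto the row space, [X = Q *m C *m P] satisfies [M *m X = P] and
    [X *m M = Q]. *)
Lemma mx_pinvP (p q : nat) (M : 'M[R]_(p, q)) :
  [/\ M *m mx_pinv M *m M = M, mx_pinv M *m M *m mx_pinv M = mx_pinv M,
      (M *m mx_pinv M)^T = M *m mx_pinv M & (mx_pinv M *m M)^T = mx_pinv M *m M].
Proof.
rewrite /mx_pinv; case: xgetP => [X _ //|/=].
set P := range_proj M; set Q := range_proj M^T.
have [[PT PP] PM] := (range_proj_orthoproj M, range_proj_id M).
have [[QT QQ] QM] := (range_proj_orthoproj M^T, range_proj_id M^T).
have [[C PC] [D QD]] := (range_proj_factor M, range_proj_factor M^T).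
rewrite -/P -/Q in PT PP PM QT QQ QM PC QD.
have MQ : M *m Q = M by rewrite -[LHS]trmxK trmx_mul QT QM trmxK.
have QD' : Q = D^T *m M by rewrite -QT QD trmx_mul trmxK.
have MX : M *m (Q *m C *m P) = P by rewrite !mulmxA MQ -PC PP.
have XM : Q *m C *m P *m M = Q.
  by rewrite -mulmxA PM {1}QD' -!mulmxA (mulmxA M) -PC PM -QD'.
move=> /(_ (Q *m C *m P)) []; split; rewrite ?MX ?XM ?PT //.
by rewrite !mulmxA QQ.
Qed.

(** Cancelling [W^T] in [N *m X *m N = N], for [N = W^T *m W], shows that [Z = W *m X *m W^T] fixes
    [W]. The same holds with [X^T], so [Z = Z^T *m Z] is symmetric and uniqueness applies. *)
Lemma pinv_gram_proj (p q : nat) (W : 'M[R]_(p, q)) :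
  W *m mx_pinv (W^T *m W) *m W^T = range_proj W.
Proof.
have [NXN _ _ _] := mx_pinvP (W^T *m W); set X := mx_pinv _ in NXN *.
have WXW Y : W^T *m W *m Y *m (W^T *m W) = W^T *m W ->
    W *m Y *m W^T *m W = W.
  (* The difference is [W *m D] with [W^T *m W *m D = 0], so its Gram matrix vanishes. *)
  move=> NYN; apply/eqP; rewrite -subr_eq0; apply/eqP/gram_eq0.
  have -> : W *m Y *m W^T *m W - W = W *m (Y *m (W^T *m W) - 1%:M).
    by rewrite mulmxBr mulmx1 !mulmxA.
  rewrite trmx_mul -mulmxA (mulmxA W^T W) mulmxBr mulmx1 (mulmxA (W^T *m W)).
  by rewrite NYN subrr mulmx0.
have ZW := WXW _ NXN.
have ZTW : W *m X^T *m W^T *m W = W.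
  apply: WXW; have := congr1 trmx NXN.
  by rewrite !trmx_mul !trmxK !mulmxA.
have ZZ : W *m X *m W^T = (W *m X *m W^T)^T *m (W *m X *m W^T).
  by rewrite !trmx_mul trmxK !mulmxA ZTW.
apply: (@range_proj_uniq _ _ _ _ (X *m W^T)) => //; last by rewrite mulmxA.
by rewrite ZZ trmx_mul trmxK.
Qed.

End OrthogonalProjection.

(** * Rayleigh quotients and the smallest nonzero eigenvalue *)

Section Rayleigh.
Import numFieldNormedType.Exports.
Context {R : realType}.

(** Row vectors match the convention of [eigenvalue] and the extreme value theorem [EVT_min_rV]. *)
Definition qform {p : nat} (Q : 'M[R]_p) (r : 'rV[R]_p) : R := (r *m Q *m r^T) 0 0.

Lemma qform_continuous (p : nat) (Q : 'M[R]_p) : continuous (qform Q).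
Proof.
have csum (F : 'I_p -> 'rV[R]_p -> R) :
    (forall j, continuous (F j)) -> continuous (fun r => \sum_j F j r).
  have cD : continuous (fun x : R * R => x.1 + x.2) by exact: add_continuous.
  move=> cF.
  exact: (@continuous_big R 'I_p +%R 0 predT cD _ (index_enum 'I_p) F
    (fun j _ => cF j)).
have -> : qform Q = (fun r : 'rV[R]_p => \sum_j (\sum_k r 0 k * Q k j) * r 0 j).
  by apply/funext => r; rewrite /qform mxE; apply: eq_bigr => j _; rewrite !mxE.
apply: (csum) => j r; apply: continuousM; last exact: coord_continuous.
apply: csum => k {}r; apply: continuousM; first exact: coord_continuous.
exact: cst_continuous.
Qed.

Lemma qformDr (p : nat) (Q : 'M[R]_p) (r s : 'rV[R]_p) :
  Q^T = Q -> qform Q (r + s) = qform Q r + 2 * (r *m Q *m s^T) 0 0 + qform Q s.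
Proof.
have addE (U V : 'M[R]_1) : (U + V) 0 0 = U 0 0 + V 0 0 by rewrite mxE.
move=> QT; rewrite /qform linearD /= mulmxDl mulmxDl !mulmxDr !addE.
suff -> : (s *m Q *m r^T) 0 0 = (r *m Q *m s^T) 0 0 by ring.
by rewrite -{1}QT -{1}(trmxK s) -!trmx_mul mulmxA mxE.
Qed.

Lemma qformZ (p : nat) (Q : 'M[R]_p) a (r : 'rV[R]_p) :
  qform Q (a *: r) = a ^+ 2 * qform Q r.
Proof.
by rewrite /qform linearZ /= -!scalemxAl -scalemxAr scalerA mxE expr2.
Qed.

Lemma qform1E (p : nat) (r : 'rV[R]_p) : qform 1%:M r = \sum_j r 0 j ^+ 2.
Proof.
by rewrite /qform mulmx1 mxE; apply: eq_bigr => j _; rewrite !mxE expr2.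
Qed.

Lemma qform1_ge0 (p : nat) (r : 'rV[R]_p) : 0 <= qform 1%:M r.
Proof. by rewrite qform1E sumr_ge0 // => j _; exact: sqr_ge0. Qed.

Lemma qform1_eq0 (p : nat) (r : 'rV[R]_p) : qform 1%:M r = 0 -> r = 0.
Proof.
rewrite /qform mulmx1 => r0; apply: trmx_inj; rewrite trmx0; apply: gram_eq0.
by rewrite trmxK [LHS]mx11_scalar r0 raddf0.
Qed.

(* The subspace is given as the fixed space of a symmetric [Q]. *)
Lemma qform_min (p : nat) (B Q : 'M[R]_p) (r0 : 'rV[R]_p) :
  Q^T = Q -> r0 *m Q = r0 -> r0 != 0 ->
  exists2 c : 'rV[R]_p, c *m Q = c /\ c != 0 &
    exists mu, qform B c = mu * qform 1%:M c /\
      forall r : 'rV[R]_p, r *m Q = r -> mu * qform 1%:M r <= qform B r.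
Proof.
move=> QT r0Q r00.
have n_gt0 (r : 'rV[R]_p) : r != 0 -> 0 < qform 1%:M r.
  move=> rn0; rewrite lt_neqAle qform1_ge0 eq_sym andbT.
  by apply: contra rn0 => /eqP/qform1_eq0 ->.
(* [D] turns the constraint [r *m Q = r] into the vanishing of a continuous quadratic form, so that
   [K] is closed. *)
pose D := (1%:M - Q) *m (1%:M - Q)^T.
have DE (r : 'rV[R]_p) : qform D r = qform 1%:M (r *m (1%:M - Q)).
  by rewrite /qform /D mulmx1 trmx_mul !mulmxA.
pose K := [set r : 'rV[R]_p | qform 1%:M r = 1] `&` [set r | qform D r = 0].
have KP (r : 'rV[R]_p) : K r <-> qform 1%:M r = 1 /\ r *m Q = r.
  split=> -[r1]; rewrite /= ?DE => h; split=> //; rewrite /= ?DE.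
    by apply/eqP; rewrite eq_sym -subr_eq0 -{1}(mulmx1 r) -mulmxBr (qform1_eq0 h).
  by rewrite mulmxBr mulmx1 h subrr /qform !mul0mx mxE.
pose nz (r : 'rV[R]_p) := (Num.sqrt (qform 1%:M r))^-1 *: r.
have nzK (r : 'rV[R]_p) : r *m Q = r -> r != 0 -> K (nz r).
  move=> rQ rn0; apply/KP; rewrite /nz qformZ exprVn sqr_sqrtr ?qform1_ge0 //.
  by rewrite mulVf ?gt_eqF ?n_gt0 // -scalemxAl rQ.
have cK : compact K.
  apply: bounded_closed_compact; last first.
    have cl (D' : 'M[R]_p) y : closed [set r | qform D' r = y].
      apply: (@preimage_closed _ _ (qform D') [set x | x = y]); last exact: closed_eq.
      by move=> r _; exact: qform_continuous.
    by apply: closedI; exact: cl.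
  (* The norm here is the largest absolute value of an entry, which is at most 1 on the Euclidean
     unit sphere. *)
  exists 1; split=> // M M1 r [r1 _]; apply: (le_trans _ (ltW M1)).
  rewrite /Num.norm /= mx_normrE; apply/bigmax_leP; split=> // -[i j] _ /=.
  rewrite ord1 -(@expr_le1 _ 2) // real_normK ?num_real //.
  rewrite -[leRHS]r1 qform1E (bigD1 j) //= lerDl sumr_ge0 // => k _.
  exact: sqr_ge0.
have [c] := @EVT_min_rV R p (qform B) K (ex_intro _ _ (nzK _ r0Q r00)) cK
  (continuous_subspaceT (@qform_continuous _ B)).
rewrite inE => /KP[c1 cQ] cmin; exists c.
  split=> //; apply/eqP => c0; move: c1.
  by rewrite c0 /qform !mul0mx mxE => /esym/eqP; rewrite oner_eq0.
exists (qform B c); split; first by rewrite c1 mulr1.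
move=> r rQ; have [->|rn0] := eqVneq r 0; first by rewrite /qform !mul0mx !mxE mulr0.
have := cmin (nz r); rewrite inE => /(_ (nzK _ rQ rn0)).
rewrite /nz qformZ exprVn sqr_sqrtr ?qform1_ge0 //.
by rewrite mulrC ler_pdivlMr ?n_gt0.
Qed.

(** The minimum [mu] of the Rayleigh quotient over the row space of [G] is attained at an
    eigenvector and is positive, so the smallest nonzero eigenvalue is at most [mu]. *)
Lemma lambda_min_pos_le (p : nat) (G M : 'M[R]_p) (r : 'rV[R]_p) :
  G^T = G -> posdef M ->
  lambda_min_pos (G *m M *m G) * qform 1%:M (r *m G) <= qform (G *m M *m G) (r *m G).
Proof.
move=> GT [MT Mpos]; set B := G *m M *m G.
have BT : B^T = B by rewrite /B !trmx_mul GT MT mulmxA.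
have BE s : qform B s = qform M (s *m G).
  by rewrite /qform /B trmx_mul GT !mulmxA.
have Mpos' (s : 'rV[R]_p) : s != 0 -> 0 < qform M s.
  move=> s0; have := Mpos s^T; rewrite trmxK; apply.
  by rewrite -(inj_eq (@trmx_inj _ _ _)) trmxK trmx0.
have M_ge0 s : 0 <= qform M s.
  have [->|/Mpos'/ltW //] := eqVneq s 0.
  by rewrite /qform !mul0mx mxE.
(* If [lambda_min_pos] takes its default value 0, the claim is just nonnegativity of the form. *)
rewrite /lambda_min_pos; case: xgetP => [lam _ [_ _ lam_min]|_]; last first.
  by rewrite mul0r BE.
have [->|rG0] := eqVneq (r *m G) 0; first by rewrite /qform !mul0mx !mxE mulr0.
set Q := range_proj G.
have [QT _] := range_proj_orthoproj G; have QG := range_proj_id G.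
rewrite -/Q in QT QG.
have GQ : G *m Q = G by rewrite -{1}GT -QT -trmx_mul QG.
have rGQ : r *m G *m Q = r *m G by rewrite -mulmxA GQ.
have [c [cQ c0] [mu [cmu mu_min]]] := @qform_min _ B Q _ QT rGQ rG0.
have [C QC] := range_proj_factor G; rewrite -/Q in QC.
(* [c *m G] is nonzero: [c = c *m Q] factors through [c *m G]. *)
have mu_gt0 : 0 < mu.
  have cc : 0 < qform 1%:M c.
    rewrite lt_neqAle qform1_ge0 eq_sym andbT.
    by apply: contra c0 => /eqP/qform1_eq0 ->.
  rewrite -(pmulr_lgt0 _ cc) -cmu BE; apply: Mpos'.
  apply: contra c0 => /eqP cG.
  by rewrite -cQ QC mulmxA cG mul0mx.
pose D := B - mu%:M.
have DT : D^T = D by rewrite /D linearB /= BT tr_scalar_mx.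
have DE s : qform D s = qform B s - mu * qform 1%:M s.
  rewrite /qform /D mulmxBr mulmxBl mul_mx_scalar -scalemxAl mulmx1.
  by rewrite [LHS]mxE [X in _ + X]mxE [X in _ - X]mxE.
have D_ge0 (s : 'rV[R]_p) : s *m Q = s -> 0 <= qform D s.
  by move=> sQ; rewrite DE subr_ge0 mu_min.
(* First variation of [qform D] at the minimizer [c] in the direction [c *m D]. *)
have cD : c *m D = 0.
  have zQ : c *m D *m Q = c *m D.
    rewrite /D mulmxBr mulmxBl mul_mx_scalar -scalemxAl cQ; congr (_ - _).
    by rewrite /B -!mulmxA GQ.
  apply: qform1_eq0; set a := qform 1%:M _; set b := qform D (c *m D).
  have b_ge0 : 0 <= b by exact: D_ge0.
  have b1 : 0 < b + 1 by rewrite ltr_wpDl.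
  have b2 : 0 < b + 2 by rewrite ltr_wpDl.
  (* With [t = a / (b + 1)], the value of the form at [c - t *: (c *m D)] is [- 2 * t * a + t ^+ 2 *
     b = - t ^+ 2 * (b + 2)]; nonnegativity forces [t = 0], hence [a = 0]. *)
  have := D_ge0 (c + - (a / (b + 1)) *: (c *m D)).
  rewrite mulmxDl -scalemxAl zQ cQ => /(_ erefl).
  rewrite qformDr // qformZ DE cmu subrr -/b.
  rewrite linearZ /= -scalemxAr mxE.
  have -> : (c *m D *m (c *m D)^T) 0 0 = a by rewrite /a /qform mulmx1.
  have -> : 0 + 2 * (- (a / (b + 1)) * a) + (- (a / (b + 1))) ^+ 2 * b =
    - (a / (b + 1)) ^+ 2 * (b + 2) by field; rewrite gt_eqF.
  rewrite mulNr oppr_ge0 pmulr_lle0 //.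
  move=> h; have /eqP : (a / (b + 1)) ^+ 2 == 0 by rewrite eq_le h sqr_ge0.
  move=> /eqP; rewrite sqrf_eq0 mulf_eq0 invr_eq0 => /orP[/eqP //|].
  by rewrite gt_eqF.
have lam_mu : lam <= mu.
  apply: lam_min; last by rewrite gt_eqF.
  apply/eigenvalueP; exists c => //.
  by apply/eqP; rewrite -subr_eq0 -mul_mx_scalar -mulmxBr cD.
by apply: le_trans (mu_min _ rGQ); rewrite ler_wpM2r ?qform1_ge0.
Qed.

End Rayleigh.

(** * Borel measurability of matrix-valued maps *)

Section MatrixMeasurability.
Import numFieldNormedType.Exports.
Context {R : realType}.

Definition mx_gen (p q : nat) : set (set 'M[R]_(p, q)) :=
  [set E | exists (i : 'I_p) (j : 'I_q) (C : set R),
     measurable C /\ E = [set M : 'M[R]_(p, q) | C (M i j)]].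

(* The Borel space of matrices: its measurable sets are [mx_borel] by conversion. *)
Definition borel_mx (p q : nat) := g_sigma_algebraType (@mx_gen p q).

Lemma mx_borel_preimage (p q : nat) (phi : 'M[R]_(p, q) -> R) (C : set R) :
  measurable_fun [set: borel_mx p q] phi -> measurable C ->
  mx_borel (phi @^-1` C).
Proof. by move=> mphi mC; rewrite -[_ @^-1` _]setTI; exact: mphi. Qed.

Lemma mx_borelT (p q : nat) : mx_borel [set: 'M[R]_(p, q)].
Proof. exact: (@measurableT _ (borel_mx p q)). Qed.

(** Inversion is continuous off 0 and constant on the closed set [[set 0]]. *)
Lemma measurable_inv : measurable_fun setT (@GRing.inv R).
Proof.
have sD : [set: R] = [set 0] `|` ~` [set 0] by rewrite setUv.
rewrite sD; apply/measurable_funU => //; first exact: measurableC.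
split; last first.
  apply: open_continuous_measurable_fun.
    by rewrite openC; exact: closed_eq.
  by move=> x; rewrite inE => /eqP; exact: inv_continuous.
apply: (eq_measurable_fun (cst 0 : R -> R)); last exact: measurable_cst.
by move=> x; rewrite inE => /= ->; rewrite invr0.
Qed.

Section Operations.
Context {d : measure_display} {T : measurableType d}.

Definition mx_measurable (p q : nat) (F : T -> 'M[R]_(p, q)) : Prop :=
  forall i j, measurable_fun setT (fun w => F w i j).

Lemma mx_measurable_cst (p q : nat) (M : 'M[R]_(p, q)) :
  mx_measurable (fun=> M).
Proof. by move=> i j; exact: measurable_cst. Qed.

Lemma mx_measurableD (p q : nat) (F G : T -> 'M[R]_(p, q)) :
  mx_measurable F -> mx_measurable G -> mx_measurable (fun w => F w + G w).
Proof.
move=> mF mG i j; under [X in measurable_fun _ X]funext do rewrite mxE.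
exact: measurable_funD.
Qed.

Lemma mx_measurableB (p q : nat) (F G : T -> 'M[R]_(p, q)) :
  mx_measurable F -> mx_measurable G -> mx_measurable (fun w => F w - G w).
Proof.
move=> mF mG i j; under [X in measurable_fun _ X]funext do rewrite !mxE.
exact: measurable_funB.
Qed.

Lemma mx_measurableM (p q r : nat) (F : T -> 'M[R]_(p, q)) (G : T -> 'M[R]_(q, r)) :
  mx_measurable F -> mx_measurable G -> mx_measurable (fun w => F w *m G w).
Proof.
move=> mF mG i j; under [X in measurable_fun _ X]funext do rewrite mxE.
by apply: measurable_sum => k; exact: measurable_funM.
Qed.

Lemma mx_measurableZ (p q : nat) (a : T -> R) (F : T -> 'M[R]_(p, q)) :
  measurable_fun setT a -> mx_measurable F -> mx_measurable (fun w => a w *: F w).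
Proof.
move=> ma mF i j; under [X in measurable_fun _ X]funext do rewrite mxE.
exact: measurable_funM.
Qed.

Lemma mx_measurable_tr (p q : nat) (F : T -> 'M[R]_(p, q)) :
  mx_measurable F -> mx_measurable (fun w => (F w)^T).
Proof.
by move=> mF i j; under [X in measurable_fun _ X]funext do rewrite mxE; exact: mF.
Qed.

Lemma mx_measurable_col (p q : nat) (F : T -> 'M[R]_(p, q)) j :
  mx_measurable F -> mx_measurable (fun w => col j (F w)).
Proof.
by move=> mF i k; under [X in measurable_fun _ X]funext do rewrite mxE; exact: mF.
Qed.

(** Gram--Schmidt uses only sums, products and scalar inverses; this explicit recursion gives the
    measurability that the choice defining [mx_pinv] hides. *)
Lemma mx_measurable_range_proj (p q : nat) (F : T -> 'M[R]_(p, q)) :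
  mx_measurable F -> mx_measurable (fun w => range_proj (F w)).
Proof.
move=> mF; rewrite /range_proj; elim: (enum _) => [|j s IH] /=.
  exact: mx_measurable_cst.
have mv : mx_measurable
    (fun w => (1%:M - foldr (gs_step (F w)) 0 s) *m col j (F w)).
  apply: mx_measurableM; last exact: mx_measurable_col.
  by apply: mx_measurableB => //; exact: mx_measurable_cst.
have mvT := mx_measurable_tr mv.
apply: mx_measurableD => //; apply: mx_measurableZ; last exact: mx_measurableM.
apply: (measurableT_comp measurable_inv).
exact: (mx_measurableM mvT mv).
Qed.

End Operations.

Lemma mx_measurable_id (p q : nat) :
  mx_measurable (fun M : borel_mx p q => M : 'M[R]_(p, q)).
Proof.
move=> i j _ C mC; rewrite setTI; apply: sub_sigma_algebra.
by exists i, j, C.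
Qed.

End MatrixMeasurability.

(** * Expectations of bounded random variables and comparison by level sets *)

Section BoundedRandomVariables.
Context {R : realType} {d : measure_display} {T : measurableType d}.
Context (P : probability T R).

(** Unlike integrability, boundedness is stable under products. *)
Definition bounded_rv (V : T -> R) : Prop :=
  measurable_fun setT V /\ exists K, forall w, `|V w| <= K.

Notation E V := (Rintegral P setT V).

Lemma bounded_rv_integrable (V : T -> R) :
  bounded_rv V -> P.-integrable setT (EFin \o V).
Proof.
move=> [mV [K VK]]; apply: measurable_bounded_integrable => //.
  by apply: le_lt_trans (ltry 1); exact: probability_le1.
by exists K; split; [exact: num_real|move=> M KM w _; apply: le_trans (VK w) (ltW KM)].
Qed.

Lemma bounded_rv_cst (c : R) : bounded_rv (fun=> c).
Proof. by split; [exact: measurable_cst|exists `|c|]. Qed.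

Lemma bounded_rvD (U V : T -> R) :
  bounded_rv U -> bounded_rv V -> bounded_rv (fun w => U w + V w).
Proof.
move=> [mU [K UK]] [mV [L VL]]; split; first exact: measurable_funD.
by exists (K + L) => w; apply: (le_trans (ler_normD _ _)); exact: lerD.
Qed.

Lemma bounded_rvM (U V : T -> R) :
  bounded_rv U -> bounded_rv V -> bounded_rv (fun w => U w * V w).
Proof.
move=> [mU [K UK]] [mV [L VL]]; split; first exact: measurable_funM.
by exists (K * L) => w; rewrite normrM; apply: ler_pM.
Qed.

Lemma bounded_rvB (U V : T -> R) :
  bounded_rv U -> bounded_rv V -> bounded_rv (fun w => U w - V w).
Proof.
move=> bU bV; have := bounded_rvD bU (bounded_rvM (bounded_rv_cst (-1)) bV).
by congr bounded_rv; apply/funext => w; rewrite mulN1r.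
Qed.

Lemma bounded_rv_sum (I : Type) (s : seq I) (V : I -> T -> R) :
  (forall i, bounded_rv (V i)) -> bounded_rv (fun w => \sum_(i <- s) V i w).
Proof.
move=> bV; elim: s => [|i s IH].
  by under [X in bounded_rv X]funext do rewrite big_nil; exact: bounded_rv_cst.
under [X in bounded_rv X]funext do rewrite big_cons.
exact: bounded_rvD.
Qed.

Lemma bounded_rv_indic (D : set T) : measurable D -> bounded_rv (\1_D : T -> R).
Proof.
move=> mD; split; first exact: measurable_indic.
by exists 1 => w; rewrite indicE; case: (_ \in _); rewrite ?normr1 ?normr0 ?ler01.
Qed.

Lemma expe_cst (c : R) : E (fun=> c) = c.
Proof.
have PT : P setT = 1%E := probability_setT P.
by rewrite Rintegral_cst // [X in fine X]PT mulr1.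
Qed.

Lemma expe_indic (D : set T) : measurable D -> E (\1_D : T -> R) = fine (P D).
Proof. by move=> mD; rewrite /Rintegral integral_indic // setIT. Qed.

(** Stated for integrable terms because the entries of [H_of] are only assumed integrable. *)
Lemma expe_integrable_sum (I : Type) (s : seq I) (V : I -> T -> R) :
  (forall i, P.-integrable setT (EFin \o V i)) ->
  P.-integrable setT (EFin \o (fun w => \sum_(i <- s) V i w)) /\
  E (fun w => \sum_(i <- s) V i w) = \sum_(i <- s) E (V i).
Proof.
move=> iV; elim: s => [|i s [iS ES]].
  rewrite big_nil; have -> : (fun w : T => \sum_(i <- [::]) V i w) = (fun=> 0).
    by apply/funext => w; rewrite big_nil.
  by split; [exact/bounded_rv_integrable/bounded_rv_cst|exact: expe_cst].
have -> : (fun w => \sum_(j <- i :: s) V j w) =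
    (fun w => V i w + \sum_(j <- s) V j w).
  by apply/funext => w; rewrite big_cons.
rewrite big_cons -ES RintegralD //; split=> //.
exact: (integrableD measurableT (iV i) iS).
Qed.

Lemma expe_sum (I : Type) (s : seq I) (V : I -> T -> R) :
  (forall i, bounded_rv (V i)) ->
  E (fun w => \sum_(i <- s) V i w) = \sum_(i <- s) E (V i).
Proof.
by move=> bV; apply: (expe_integrable_sum _ _).2 => i; exact: bounded_rv_integrable.
Qed.

Lemma expeMl (c : R) (V : T -> R) :
  bounded_rv V -> E (fun w => c * V w) = c * E V.
Proof. by move=> bV; rewrite RintegralZl //; exact: bounded_rv_integrable. Qed.

Lemma expe_norm_le (V : T -> R) K :
  bounded_rv V -> (forall w, `|V w| <= K) -> `|E V| <= K.
Proof.
move=> bV VK; apply: (le_trans (le_normr_Rintegral _ (bounded_rv_integrable bV))) => //.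
rewrite -[leRHS]expe_cst; apply: le_Rintegral => //.
- apply: bounded_rv_integrable; case: bV => mV _; split.
    exact: measurableT_comp.
  by exists K => w; rewrite normr_id.
- exact/bounded_rv_integrable/bounded_rv_cst.
Qed.

(** The sum counts the levels [j.+1 <= N * x]. There are [t], the integer part of [N * x], so the
    error is the fractional part divided by [N]. *)
Lemma step_approx (x : R) (N : nat) : 0 <= x <= 1 -> (0 < N)%N ->
  `|x - \sum_(j < N) N%:R^-1 * ((j.+1%:R / N%:R <= x)%R)%:R| <= N%:R^-1.
Proof.
move=> /andP[x0 x1] N0; have NR : 0 < N%:R :> R by rewrite ltr0n.
pose t := Num.truncn (N%:R * x).
have Nx0 : 0 <= N%:R * x by rewrite mulr_ge0 // ltW.
have /andP[tx xt] := truncn_itv Nx0; rewrite -/t in tx xt.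
have tN : (t <= N)%N.
  rewrite -(ler_nat R); apply: (le_trans tx).
  by rewrite ger_pMr.
have -> : \sum_(j < N) N%:R^-1 * ((j.+1%:R / N%:R <= x)%R)%:R = N%:R^-1 * t%:R :> R.
  rewrite -mulr_sumr; congr (_ * _).
  under eq_bigr => j _.
    rewrite ler_pdivrMr // (mulrC x) -truncn_gt_nat -/t.
    over.
  rewrite -(@natr_sum R) -big_mkcond /= (big_ord_narrow tN) sum_nat_const.
  by rewrite card_ord muln1.
rewrite -(ler_pM2l NR) mulfV ?gt_eqF // -{1}(gtr0_norm NR) -normrM mulrBr mulrA.
rewrite mulfV ?gt_eqF // mul1r ger0_norm ?subr_ge0 //.
by rewrite lerBlDr addrC natr1 ltW.
Qed.

(* [X] and [X'] are uniform limits of combinations of the indicators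
   [j / N <= X] and [j / N <= X']. *)
Lemma expeM_levels01 (U U' X X' : T -> R) :
  bounded_rv U -> bounded_rv U' -> bounded_rv X -> bounded_rv X' ->
  (forall w, 0 <= X w <= 1) -> (forall w, 0 <= X' w <= 1) ->
  (forall t, E (fun w => U w * ((t <= X w)%R)%:R) = E (fun w => U' w * ((t <= X' w)%R)%:R)) ->
  E (fun w => U w * X w) = E (fun w => U' w * X' w).
Proof.
move=> bU bU' bX bX' X01 X'01 UU'.
have bI (Y : T -> R) t : bounded_rv Y -> bounded_rv (fun w => ((t <= Y w)%R)%:R : R).
  move=> [mY _]; have : measurable (Y @^-1` `[t, +oo[).
    by rewrite -[_ @^-1` _]setTI; exact: mY.
  move=> /bounded_rv_indic; congr bounded_rv; apply/funext => w.
  rewrite indicE; suff -> : (w \in Y @^-1` `[t, +oo[) = (t <= Y w) by [].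
  by apply/idP/idP; rewrite inE /= in_itv /= andbT.
have app (V Y : T -> R) : bounded_rv V -> bounded_rv Y -> (forall w, 0 <= Y w <= 1) ->
    exists K, forall N, (0 < N)%N ->
    `|E (fun w => V w * Y w) -
      \sum_(j < N) N%:R^-1 * E (fun w => V w * ((j.+1%:R / N%:R <= Y w)%R)%:R)| <= K / N%:R.
  move=> bV bY Y01; have [_ [K VK]] := bV; exists K => N N0.
  have bVI t := bounded_rvM bV (bI Y t bY).
  have bS : bounded_rv (fun w => \sum_(j < N)
      N%:R^-1 * (V w * ((j.+1%:R / N%:R <= Y w)%R)%:R)).
    by apply: bounded_rv_sum => j; apply: bounded_rvM => //; exact: bounded_rv_cst.
  have -> : \sum_(j < N) N%:R^-1 * E (fun w => V w * ((j.+1%:R / N%:R <= Y w)%R)%:R) =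
      E (fun w => \sum_(j < N) N%:R^-1 * (V w * ((j.+1%:R / N%:R <= Y w)%R)%:R)).
    rewrite expe_sum; first by apply: eq_bigr => j _; rewrite expeMl.
    by move=> j; apply: bounded_rvM => //; exact: bounded_rv_cst.
  have bVY := bounded_rvM bV bY.
  rewrite -RintegralB //; try exact: bounded_rv_integrable.
  apply: expe_norm_le; first exact: bounded_rvB.
  move=> w; under eq_bigr do rewrite mulrCA.
  rewrite -mulr_sumr -mulrBr normrM; apply: ler_pM => //.
  exact: step_approx.
have [K hK] := app _ _ bU bX X01; have [K' hK'] := app _ _ bU' bX' X'01.
apply/eqP; rewrite -subr_eq0 -normr_le0 leNgt; apply/negP => e0.
set e := `|_| in e0.
(* The approximating sums of the two sides coincide by [UU'], so only the two approximation errors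
   remain. *)
have eN (N : nat) : (0 < N)%N -> e <= (K + K') / N%:R.
  move=> N0; have := hK _ N0; have := hK' _ N0.
  under eq_bigr do rewrite -UU'.
  move=> h h'; rewrite /e mulrDl.
  have := lerD h' h; apply: le_trans.
  by rewrite [X in _ <= _ + X]distrC (le_trans _ (ler_normD _ _)) // addrA subrK.
have KK : 0 < K + K'.
  by rewrite (lt_le_trans e0) // (le_trans (eN 1%N isT)) // divr1.
(* This [N] exceeds [(K + K') / e], contradicting the bound. *)
have := eN (Num.truncn ((K + K') / e)).+1 isT.
rewrite ler_pdivlMr ?ltr0n // mulrC -ler_pdivlMr // leNgt => /negP; apply.
exact: truncnS_gt.
Qed.

(** Reduction to values in [0, 1] by the map taking [y] to [(y + m) / (2 * m)], which carries level
    sets to level sets. *)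
Lemma expeM_levels (U U' X X' : T -> R) (M : R) :
  bounded_rv U -> bounded_rv U' -> measurable_fun setT X -> measurable_fun setT X' ->
  (forall w, `|X w| <= M) -> (forall w, `|X' w| <= M) ->
  (forall t, E (fun w => U w * ((t <= X w)%R)%:R) = E (fun w => U' w * ((t <= X' w)%R)%:R)) ->
  E (fun w => U w * X w) = E (fun w => U' w * X' w).
Proof.
move=> bU bU' mX mX' XM X'M UU'; pose m : R := `|M| + 1.
have m0 : 0 < m by rewrite ltr_wpDl.
have lem (Y : T -> R) w : (forall w, `|Y w| <= M) -> - m <= Y w <= m.
  move=> YM; rewrite -ler_norml (le_trans (YM w)) // /m.
  by rewrite (le_trans (ler_norm M)) // lerDl.
have bX : bounded_rv X by split=> //; exists M.
have bX' : bounded_rv X' by split=> //; exists M.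
have aff (Y : T -> R) w : (2 * m)^-1 * (Y w + m) * (2 * m) - m = Y w.
  by field; rewrite gt_eqF.
have b1 (Y : T -> R) : bounded_rv Y -> bounded_rv (fun w => (2 * m)^-1 * (Y w + m)).
  by move=> bY; apply: bounded_rvM; [|apply: bounded_rvD => //]; exact: bounded_rv_cst.
have in01 (Y : T -> R) : (forall w, `|Y w| <= M) -> forall w, 0 <= (2 * m)^-1 * (Y w + m) <= 1.
  move=> YM w; have /andP[l u] := lem _ w YM.
  rewrite mulr_ge0 ?invr_ge0 ?mulr_ge0 ?(ltW m0) //=; last by rewrite -lerBlDr sub0r.
  by rewrite ler_pdivrMl ?mulr_gt0 // mulr1 mulr_natl mulr2n lerD2r.
(* At level [- m] both indicators are identically 1. This equality is what allows the shift by [m]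
   to be undone. *)
have EU : E U = E U'.
  have h (Y : T -> R) w : (forall w, `|Y w| <= M) -> ((- m <= Y w)%R)%:R = 1 :> R.
    by move=> YM; have /andP[-> _] := lem _ w YM.
  have := UU' (- m); under eq_Rintegral do rewrite (h X) // mulr1.
  by under [RHS]eq_Rintegral do rewrite (h X') // mulr1.
have E01 := expeM_levels01 bU bU' (b1 _ bX) (b1 _ bX') (in01 _ XM) (in01 _ X'M).
have {}E01 : E (fun w => U w * ((2 * m)^-1 * (X w + m))) =
             E (fun w => U' w * ((2 * m)^-1 * (X' w + m))).
  apply: E01 => t.
  have h (Y : T -> R) w : (t <= (2 * m)^-1 * (Y w + m)) = (2 * m * t - m <= Y w) :> bool.
    by rewrite ler_pdivlMl ?mulr_gt0 // lerBlDr.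
  under eq_Rintegral do rewrite (h X).
  by under [RHS]eq_Rintegral do rewrite (h X').
have key (V Y : T -> R) : bounded_rv V -> bounded_rv Y -> E (fun w => V w * Y w) =
    2 * m * E (fun w => V w * ((2 * m)^-1 * (Y w + m))) - m * E V.
  move=> bV bY; have bVY := bounded_rvM bV (b1 _ bY).
  rewrite -!expeMl // -RintegralB //; last 2 first.
  - by apply/bounded_rv_integrable/bounded_rvM => //; exact: bounded_rv_cst.
  - by apply/bounded_rv_integrable/bounded_rvM => //; exact: bounded_rv_cst.
  by apply: eq_Rintegral => w _; rewrite -{1}(aff Y w); ring.
by rewrite (key U X) // (key U' X') // E01 EU.
Qed.

End BoundedRandomVariables.

(** * Independence of the present sample from the past *)

Section Independence.
Import numFieldNormedType.Exports.
Context {R : realType} {d : measure_display} {T : measurableType d}.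
Context (P : probability T R) {p q : nat} (S : nat -> T -> 'M[R]_(p, q)).
Hypotheses (HS : forall k, random_mx (S k)) (Hind : mx_indep P S).
Hypothesis (Hid : mx_ident_distr P S).

Notation E V := (Rintegral P setT V).

(** Finite cylinders over [S k, S k.+1, ...]. The trivial factors below [k] fit the products of
    [mx_indep], which start at 0. *)
Definition future_rect (k : nat) (D : set T) : Prop :=
  exists N (B : nat -> set 'M[R]_(p, q)),
    [/\ (k <= N)%N, forall i, mx_borel (B i), forall i, (i < k)%N -> B i = setT &
        D = \big[setI/setT]_(i < N) (S i @^-1` B i)].

Lemma future_rect_measurable k D : future_rect k D -> measurable D.
Proof.
by move=> [N [B [_ mB _ ->]]]; apply: bigsetI_measurable => i _; exact: HS.
Qed.

Lemma future_rectT k : future_rect k setT.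
Proof.
exists k, (fun=> setT); split=> // [_|]; first exact: mx_borelT.
by rewrite big1.
Qed.

(** [D] leaves coordinate [k] free, so [B0] can be put there. Independence applied to both
    rectangles then splits off exactly that factor. *)
Lemma future_rectI k B0 D : mx_borel B0 -> future_rect k.+1 D ->
  future_rect k (S k @^-1` B0 `&` D) /\
  P (S k @^-1` B0 `&` D) = (P (S k @^-1` B0) * P D)%E.
Proof.
move=> mB0 [N [B [kN mB BT ->]]].
pose B' i := if i == k then B0 else B i.
have mB' i : mx_borel (B' i) by rewrite /B'; case: eqP.
have eqI : S k @^-1` B0 `&` \big[setI/setT]_(i < N) (S i @^-1` B i) =
           \big[setI/setT]_(i < N) (S i @^-1` B' i).
  rewrite (bigD1 (Ordinal kN)) //= [RHS](bigD1 (Ordinal kN)) //= BT //.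
  rewrite preimage_setT setTI /B' eqxx; congr (_ `&` _).
  apply: eq_bigr => i ik; case: eqP => // ik'.
  by move: ik; rewrite -val_eqE /= ik' eqxx.
split.
  exists N, B'; split=> //; first exact: ltnW.
  by move=> i ik; rewrite /B' ltn_eqF // BT // ltnW.
rewrite eqI !Hind // (bigD1 (Ordinal kN)) //= [in RHS](bigD1 (Ordinal kN)) //= BT //.
have PT : P setT = 1%E := probability_setT P.
rewrite preimage_setT [P setT]PT mul1e {1}/B' eqxx; congr (_ * _)%E.
apply: eq_bigr => i ik; rewrite /B'; case: eqP => // ik'.
by move: ik; rewrite -val_eqE /= ik' eqxx.
Qed.

(* Being uncorrelated with the pi-system generating sigma(S k, S k.+1, ...) stands in for
   measurability with respect to the sigma-algebra of [S 0, ..., S k.-1]. *)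
Definition past (k : nat) (V : T -> R) : Prop :=
  bounded_rv V /\
  forall D, future_rect k D -> E (fun w => V w * \1_D w) = E V * fine (P D).

Lemma past_cst c : past 0 (fun=> c).
Proof.
split; first exact: bounded_rv_cst.
move=> D /future_rect_measurable mD; rewrite expe_cst expeMl ?expe_indic //.
exact: bounded_rv_indic.
Qed.

Lemma past_sum k (I : Type) (s : seq I) (V : I -> T -> R) :
  (forall i, past k (V i)) -> past k (fun w => \sum_(i <- s) V i w).
Proof.
move=> pV; have bV i : bounded_rv (V i) by have [] := pV i.
split; first exact: bounded_rv_sum.
move=> D fD; under eq_Rintegral do rewrite mulr_suml.
rewrite !expe_sum // ?mulr_suml; first by apply: eq_bigr => i _; apply: (pV i).2.
move=> i; apply: bounded_rvM => //.
exact/bounded_rv_indic/(future_rect_measurable fD).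
Qed.

(** Level sets reduce [phi (S k w)] to indicators of events on [S k]. Such an event intersected with
    a rectangle over later samples is a rectangle from [k] on, where [past k V] applies. *)
Lemma past_step k (V : T -> R) (phi : 'M[R]_(p, q) -> R) M :
  past k V -> measurable_fun [set: borel_mx p q] phi -> (forall A, `|phi A| <= M) ->
  past k.+1 (fun w => V w * phi (S k w)) /\
  E (fun w => V w * phi (S k w)) = E V * E (fun w => phi (S 0%N w)).
Proof.
move=> [bV pV] mphi phiM.
have mX i : measurable_fun setT (fun w => phi (S i w)).
  move=> _ C mC; rewrite setTI; exact: (HS i (mx_borel_preimage mphi mC)).
have bX i : bounded_rv (fun w => phi (S i w)) by split=> //; exists M.
pose B t := phi @^-1` `[t, +oo[.
have mB t : mx_borel (B t) by exact: mx_borel_preimage.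
have levelE i t w : ((t <= phi (S i w))%R)%:R = \1_(S i @^-1` B t) w :> R.
  rewrite indicE; suff -> : (w \in S i @^-1` B t) = (t <= phi (S i w)) by [].
  by apply/idP/idP; rewrite inE /B /= in_itv /= andbT.
have mS i t : measurable (S i @^-1` B t) by exact: HS.
have VS t : E (fun w => V w * \1_(S k @^-1` B t) w) = E V * fine (P (S k @^-1` B t)).
  have [fS _] := future_rectI (mB t) (future_rectT k.+1).
  by apply: pV; rewrite setIT in fS.
split; last first.
  (* Compares the weight [V] on [phi (S k w)] with the constant weight [E V] on [phi (S 0 w)]; [Hid]
     equates the level probabilities. *)
  rewrite -expeMl //; apply: (@expeM_levels _ _ _ P _ _ _ _ M) => //.
    exact: bounded_rv_cst.
  move=> t; under eq_Rintegral do rewrite levelE.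
  under [RHS]eq_Rintegral do rewrite levelE.
  by rewrite VS expeMl ?expe_indic ?Hid //; exact: bounded_rv_indic.
split; first exact: bounded_rvM.
move=> D fD; have mD := future_rect_measurable fD.
have bD : bounded_rv (\1_D : T -> R) by exact: bounded_rv_indic.
under eq_Rintegral do rewrite mulrAC.
rewrite mulrC -expeMl; last exact: bounded_rvM.
under [RHS]eq_Rintegral do rewrite mulrA.
(* Both sides integrate [phi (S k w)], against the weights [V * \1_D] and [fine (P D) * V]. *)
apply: (@expeM_levels _ _ _ P _ _ _ _ M) => //.
- exact: bounded_rvM.
- by apply: bounded_rvM => //; exact: bounded_rv_cst.
move=> t; under eq_Rintegral do rewrite levelE.
under [RHS]eq_Rintegral do rewrite levelE.
have [fSD PSD] := future_rectI (mB t) fD.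
transitivity (E V * fine (P (S k @^-1` B t `&` D))).
  rewrite -pV //; apply: eq_Rintegral => w _.
  by rewrite indicI -mulrA [X in _ * X]mulrC.
under [RHS]eq_Rintegral do rewrite -mulrA.
rewrite expeMl; last by apply: bounded_rvM => //; exact: bounded_rv_indic.
rewrite VS PSD fineM ?fin_num_measure //.
by rewrite [LHS]mulrA [LHS]mulrC.
Qed.

End Independence.

(** * Deterministic algebra of the errors *)

Section Iterates.
Context {R : realType}.

Lemma frob_sqr (p q : nat) (M : 'M[R]_(p, q)) :
  frob M ^+ 2 = \sum_j qform 1%:M (row j M^T).
Proof.
rewrite /frob sqr_sqrtr; last first.
  by apply: sumr_ge0 => i _; apply: sumr_ge0 => j _; exact: sqr_ge0.
rewrite exchange_big; apply: eq_bigr => j _; rewrite qform1E.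
by apply: eq_bigr => i _; rewrite !mxE.
Qed.

Lemma qform_rows (p q : nat) (C : 'M[R]_p) (Y : 'M[R]_(p, q)) :
  \sum_j qform C (row j Y^T) = \sum_j \sum_a \sum_b Y a j * Y b j * C a b.
Proof.
apply: eq_bigr => j _; rewrite /qform mxE exchange_big; apply: eq_bigr => b _.
rewrite !mxE mulr_suml; apply: eq_bigr => a _; rewrite !mxE; ring.
Qed.

(** [Q^T *m Q = Q] makes the squared norm linear in [Q], so that an expectation of [Q] can later be
    taken inside. *)
Lemma frob_orthoproj (p q : nat) (Q : 'M[R]_p) (Y : 'M[R]_(p, q)) :
  orthoproj Q -> frob (Q *m Y) ^+ 2 = \sum_j qform Q (row j Y^T).
Proof.
move=> [QT QQ]; rewrite frob_sqr; apply: eq_bigr => j _.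
rewrite trmx_mul QT row_mul /qform mulmx1 trmx_mul QT mulmxA.
by rewrite -(mulmxA _ Q Q) QQ.
Qed.

(** No sign is assumed on [rho]: if it is negative, [0 <= e k.+1 <= rho * e k] forces every [e k] to
    vanish. *)
Lemma geometric_bound (rho : R) (e : nat -> R) :
  (forall k, 0 <= e k) -> (forall k, e k.+1 <= rho * e k) ->
  forall k, e k <= rho ^+ k * e 0%N.
Proof.
move=> e_ge0 erho; have [rho0|rho0] := leP 0 rho.
  elim=> [|k IH]; first by rewrite expr0 mul1r.
  by rewrite (le_trans (erho k)) // exprS -mulrA ler_wpM2l.
have e0 k : e k = 0.
  apply/eqP; rewrite eq_le e_ge0 andbT -(nmulr_rge0 _ rho0).
  exact: le_trans (e_ge0 _) (erho k).
by move=> k; rewrite !e0 mulr0.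
Qed.

Lemma conj_H_of (m n tau : nat) (A : 'M[R]_(m, n)) (M : 'M[R]_(n, tau)) :
  A^T *m A *m H_of A M *m (A^T *m A) = range_proj (A^T *m A *m M).
Proof.
by rewrite -pinv_gram_proj /H_of !trmx_mul trmxK !mulmxA.
Qed.

(** Since [A *m mx_pinv A] is symmetric, the left side is the transpose of [A *m mx_pinv A *m A]. *)
Lemma normal_pinv (m n : nat) (A : 'M[R]_(m, n)) : A^T *m A *m mx_pinv A = A^T.
Proof.
have [AXA _ AXT _] := mx_pinvP A.
by rewrite -mulmxA -AXT -trmx_mul AXA.
Qed.

Lemma range_pinv (m n : nat) (A : 'M[R]_(m, n)) :
  exists V, mx_pinv A = A^T *m A *m V.
Proof.
have [_ XAX _ XAT] := mx_pinvP A.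
exists (mx_pinv A *m (mx_pinv A)^T *m mx_pinv A).
by rewrite !mulmxA normal_pinv -trmx_mul XAT XAX.
Qed.

Lemma range_subP (p q r : nat) (M : 'M[R]_(p, q)) (N : 'M[R]_(p, r)) :
  range_sub M N -> exists V, M = N *m V.
Proof.
move=> /submxP[D MD]; exists D^T.
by rewrite -[LHS]trmxK MD trmx_mul trmxK.
Qed.

Section Errors.
Context {T : Type} {m n tau : nat} (A : 'M[R]_(m, n)) (S : nat -> T -> 'M[R]_(n, tau)).
Context (X0 : 'M[R]_(n, m)).

Let G := A^T *m A.
Let Y k w := Xit A X0 S k w - mx_pinv A.

Lemma error_step k w :
  Y k.+1 w = (1%:M - G *m H_of A (S k w) *m G) *m Y k w.
Proof.
(* By [normal_pinv], the identity in the residual acts as [A *m mx_pinv A] under [A^T]. *)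
have res : A^T *m (A *m Xit A X0 S k w - 1%:M) = G *m Y k w.
  by rewrite !mulmxBr mulmx1 normal_pinv mulmxA.
have -> : (1%:M - G *m H_of A (S k w) *m G) *m Y k w =
    Y k w - G *m H_of A (S k w) *m (G *m Y k w).
  by rewrite mulmxBl mul1mx mulmxA.
by rewrite -res /Y /= addrAC /H_of !mulmxA.
Qed.

(** [X0] and the pseudoinverse start in the range of [G], and every update is a left multiple by
    [G]. *)
Lemma error_range k w : range_sub X0 G -> exists V, Y k w = G *m V.
Proof.
move=> /range_subP[V0 X0V]; elim: k => [|k [V YV]].
  have [V1 AV1] := range_pinv A.
  by exists (V0 - V1); rewrite /Y /= mulmxBr -X0V -AV1.
exists (V - H_of A (S k w) *m G *m Y k w).
by rewrite error_step [in RHS]mulmxBr -YV mulmxBl mul1mx !mulmxA.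
Qed.

End Errors.
End Iterates.

(** * Expected error and mean-square contraction *)

Section Convergence.
Import numFieldNormedType.Exports.
Context {R : realType} {m n tau : nat} (A : 'M[R]_(m, n)).
Context {d : measure_display} {T : measurableType d} (P : probability T R).
Context (S : nat -> T -> 'M[R]_(n, tau)) (X0 : 'M[R]_(n, m)).
Hypotheses (HS : forall k, random_mx (S k)) (Hind : mx_indep P S).
Hypothesis (Hid : mx_ident_distr P S).

Notation E V := (Rintegral P setT V).
Let G := A^T *m A.
Let Y k w := Xit A X0 S k w - mx_pinv A.
Let Q (M : 'M[R]_(n, tau)) : 'M[R]_n := 1%:M - range_proj (G *m M).

Let errorE k w : Y k.+1 w = Q (S k w) *m Y k w.
Proof. by rewrite /Y error_step conj_H_of. Qed.

Let Q_orthoproj M : orthoproj (Q M).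
Proof. exact/orthoproj_compl/range_proj_orthoproj. Qed.

Let Q_le1 i j M : `|Q M i j| <= 1.
Proof. exact: orthoproj_entry_le1. Qed.

Let Q_measurable i j : measurable_fun [set: borel_mx n tau] (fun M => Q M i j).
Proof.
apply: (mx_measurableB (mx_measurable_cst _)).
apply: mx_measurable_range_proj; apply: mx_measurableM; last exact: mx_measurable_id.
exact: mx_measurable_cst.
Qed.

Let QM_le1 i j a b M : `|Q M i j * Q M a b| <= 1.
Proof. by rewrite normrM mulr_ile1. Qed.

Let QM_measurable i j a b :
  measurable_fun [set: borel_mx n tau] (fun M => Q M i j * Q M a b).
Proof. by apply: measurable_funM; exact: Q_measurable. Qed.

Lemma past_error k i j : past P S k (fun w => Y k w i j).
Proof.
elim: k i j => [|k IH] i j; first exact: (past_cst P HS ((X0 - mx_pinv A) i j)).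
under [X in past _ _ _ X]funext do
  (rewrite errorE mxE; under eq_bigr do rewrite mulrC).
apply: past_sum => // l.
by have [] := past_step HS Hind Hid (IH l j) (Q_measurable i l) (Q_le1 i l).
Qed.

(** Second moments need products of entries. [past] is not closed under products by definition, so
    the pairs get their own induction. *)
Lemma past_errorM k i j a b : past P S k (fun w => Y k w i j * Y k w a b).
Proof.
elim: k i j a b => [|k IH] i j a b.
  exact: (past_cst P HS ((X0 - mx_pinv A) i j * (X0 - mx_pinv A) a b)).
under [X in past _ _ _ X]funext do
  (rewrite errorE !mxE mulr_suml; under eq_bigr do
    (rewrite mulr_sumr; under eq_bigr do rewrite mulrACA mulrC)).
apply: past_sum => // l; apply: past_sum => // h.
by have [] := past_step HS Hind Hid (IH l j h b) (QM_measurable i l a h) (QM_le1 i l a h).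
Qed.

Lemma mexp_error k :
  mexp P (Y k.+1) = mexp P (fun w => Q (S 0%N w)) *m mexp P (Y k).
Proof.
apply/matrixP => i j; rewrite !mxE.
under eq_Rintegral do (rewrite errorE mxE; under eq_bigr do rewrite mulrC).
have st l := past_step HS Hind Hid (past_error k l j) (Q_measurable i l) (Q_le1 i l).
rewrite expe_sum => [|l]; last by have [[]] := st l.
by apply: eq_bigr => l _; rewrite (st l).2 !mxE mulrC.
Qed.

Lemma bounded_frob_error k : bounded_rv (fun w => frob (Y k w) ^+ 2).
Proof.
under [X in bounded_rv X]funext do rewrite frob_sqr qform_rows.
apply: bounded_rv_sum => j; apply: bounded_rv_sum => a; apply: bounded_rv_sum => b.
apply: bounded_rvM; last exact: bounded_rv_cst.
by have [] := past_errorM k a j b j.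
Qed.

(** By [frob_orthoproj] the integrand is linear in [Q (S k w)], whose entries factor out of the
    expectation by independence. *)
Lemma expe_frob_error k :
  E (fun w => frob (Y k.+1 w) ^+ 2) =
  E (fun w => \sum_j qform (mexp P (fun w => Q (S 0%N w))) (row j (Y k w)^T)).
Proof.
under eq_Rintegral do rewrite errorE frob_orthoproj // qform_rows.
under [RHS]eq_Rintegral do rewrite qform_rows.
have st j a b := past_step HS Hind Hid (past_errorM k a j b j)
  (Q_measurable a b) (Q_le1 a b).
have b1 j a b : bounded_rv (fun w => Y k w a j * Y k w b j * Q (S k w) a b).
  by have [[]] := st j a b.
have b2 j a b : bounded_rv (fun w => Y k w a j * Y k w b j *
    mexp P (fun w => Q (S 0%N w)) a b).
  apply: bounded_rvM; last exact: bounded_rv_cst.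
  by have [] := past_errorM k a j b j.
rewrite !expe_sum; try by move=> *; do ?[apply: bounded_rv_sum => ?].
apply: eq_bigr => j _.
rewrite !expe_sum; try by move=> *; do ?[apply: bounded_rv_sum => ?].
apply: eq_bigr => a _; rewrite !expe_sum //; apply: eq_bigr => b _.
rewrite (st j a b).2 mxE RintegralZr //.
by apply: bounded_rv_integrable; have [] := past_errorM k a j b j.
Qed.

Lemma mexp_conj (C : 'M[R]_n) (F : T -> 'M[R]_n) :
  mx_integrable P F ->
  mx_integrable P (fun w => C *m F w *m C) /\
  mexp P (fun w => C *m F w *m C) = C *m mexp P F *m C.
Proof.
move=> iF.
have iZ (c : R) V : P.-integrable setT (EFin \o V) ->
    P.-integrable setT (EFin \o (fun w => c * V w)).
  by move=> iV; exact: (@integrableZl _ _ _ _ _ measurableT c _ iV).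
have CFC i j w : (C *m F w *m C) i j = \sum_l \sum_h C l j * C i h * F w h l.
  rewrite mxE; apply: eq_bigr => l _; rewrite mxE mulr_suml.
  by apply: eq_bigr => h _; rewrite mulrC mulrA.
have sum1 (i j l : 'I_n) := expe_integrable_sum (index_enum 'I_n)
  (fun h => iZ (C l j * C i h) _ (iF h l)).
have sum2 (i j : 'I_n) := expe_integrable_sum (index_enum 'I_n) (fun l => (sum1 i j l).1).
have funE i j : (fun w => (C *m F w *m C) i j) =
    (fun w => \sum_l \sum_h C l j * C i h * F w h l).
  by apply/funext => w; exact: CFC.
split.
  move=> i j; have := (sum2 i j).1; congr (P.-integrable _ _).
  by apply/funext => w; rewrite CFC.
apply/matrixP => i j; rewrite [LHS]mxE funE (sum2 i j).2 mxE.
apply: eq_bigr => l _; rewrite (sum1 i j l).2 mxE mulr_suml.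
by apply: eq_bigr => h _; rewrite mxE RintegralZl //; [ring|exact: iF].
Qed.

Hypothesis (iH : mx_integrable P (fun w => H_of A (S 0%N w))).
Hypothesis (posH : posdef (mexp P (fun w => H_of A (S 0%N w)))).
Let B := G *m mexp P (fun w => H_of A (S 0%N w)) *m G.

(** Integrability of [H_of] enters here, to move the expectation inside the conjugation by [G]. *)
Lemma mexp_compl_proj : mexp P (fun w => Q (S 0%N w)) = 1%:M - B.
Proof.
have [iB BE] := mexp_conj G iH; apply/matrixP => i j.
rewrite /B -BE !mxE -[X in X - _](expe_cst P) -RintegralB //.
- by apply: eq_Rintegral => w _; rewrite conj_H_of !mxE.
- exact/bounded_rv_integrable/bounded_rv_cst.
- exact: iB.
Qed.

(** The inequality holds pointwise in [w], column by column: each column of the error lies in the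
    range of [G], where [lambda_min_pos_le] applies. *)
Lemma expe_frob_contract k : range_sub X0 G ->
  E (fun w => frob (Y k.+1 w) ^+ 2) <=
  (1 - lambda_min_pos B) * E (fun w => frob (Y k w) ^+ 2).
Proof.
move=> HX0; rewrite expe_frob_error -expeMl; last exact: bounded_frob_error.
apply: le_Rintegral => //.
- apply: bounded_rv_integrable.
  under [X in bounded_rv X]funext do rewrite qform_rows.
  apply: bounded_rv_sum => j; apply: bounded_rv_sum => a; apply: bounded_rv_sum => b.
  apply: bounded_rvM; last exact: bounded_rv_cst.
  by have [] := past_errorM k a j b j.
- apply: bounded_rv_integrable; apply: bounded_rvM; first exact: bounded_rv_cst.
  exact: bounded_frob_error.
move=> w _; rewrite frob_sqr mulr_sumr; apply: ler_sum => j _.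
rewrite mexp_compl_proj.
have GT : G^T = G by rewrite /G trmx_mul trmxK.
have [V YV] := error_range S k w HX0.
have -> : row j (Y k w)^T = row j V^T *m G by rewrite /Y YV trmx_mul GT row_mul.
set r := row j V^T *m G.
have -> : qform (1%:M - B) r = qform 1%:M r - qform B r.
  by rewrite /qform mulmxBr mulmxBl [LHS]mxE [X in _ + X]mxE.
rewrite mulrBl mul1r lerB //.
exact: lambda_min_pos_le.
Qed.

Lemma integral_frob_error k :
  (\int[P]_w (frob (Y k w) ^+ 2)%:E)%E = (E (fun w => frob (Y k w) ^+ 2))%:E.
Proof.
have iY := bounded_rv_integrable P (bounded_frob_error k).
by rewrite /Rintegral fineK //; exact: integrable_fin_num iY.
Qed.

End Convergence.

(** * Error recursion and geometric rate *)

Theorem theorem2 (R : realType) (m n tau : nat) (A : 'M[R]_(m, n))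
  (d : measure_display) (T : measurableType d) (P : probability T R)
  (S : nat -> T -> 'M[R]_(n, tau))
  (HS : forall k, random_mx (S k)) (Hind : mx_indep P S)
  (Hid : mx_ident_distr P S)
  (X0 : 'M[R]_(n, m)) (HX0 : range_sub X0 (A^T *m A)) :
  (forall k,
     mexp P (fun w => Xit A X0 S k.+1 w - mx_pinv A) =
     mexp P (fun w => 1%:M - (A^T *m A) *m H_of A (S 0%N w) *m (A^T *m A))
       *m mexp P (fun w => Xit A X0 S k w - mx_pinv A)) /\
  (mx_integrable P (fun w => H_of A (S 0%N w)) ->
   posdef (mexp P (fun w => H_of A (S 0%N w))) ->
   let rho := 1 - lambda_min_pos ((A^T *m A) *m mexp P (fun w => H_of A (S 0%N w)) *m (A^T *m A)) in
   forall k,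
     (\int[P]_w ((frob (Xit A X0 S k w - mx_pinv A)) ^+ 2)%:E
        <= (rho ^+ k * (frob (X0 - mx_pinv A)) ^+ 2)%:E)%E).
Proof.
split=> [k|iH posH rho k].
  rewrite (mexp_error A X0 HS Hind Hid); congr (mexp P _ *m _).
  by apply/funext => w; rewrite conj_H_of.
rewrite (integral_frob_error A X0 HS Hind Hid) lee_fin.
(* The initial error is deterministic, so its squared norm is the zeroth term of the sequence of
   expectations. *)
have -> : frob (X0 - mx_pinv A) ^+ 2 =
    Rintegral P setT (fun w => frob (Xit A X0 S 0 w - mx_pinv A) ^+ 2).
  exact: (esym (expe_cst P (frob (X0 - mx_pinv A) ^+ 2))).
apply: (geometric_bound (e := fun k =>
  Rintegral P setT (fun w => frob (Xit A X0 S k w - mx_pinv A) ^+ 2))).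
  by move=> l; apply: Rintegral_ge0 => w _; exact: sqr_ge0.
by move=> l; exact: expe_frob_contract.
Qed.
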